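(* Let $A_{\mathbb R}$ be a quiver of continuous type $A$ and $k$ a field. Any indecomposable projective object in the category $\mathrm{Rep}_k^{\mathrm{pwf}}(A_{\mathbb R})$ of pointwise finite-dimensional representations is isomorphic to one of the following, where in (2) and (3) $a$ may be $\pm\infty$. (1) $P_a$, for $-\infty<a<+\infty$: $P_a(x)=k$ if $x\preceq a$ and $0$ otherwise; $P_a(x,y)=1_k$ if $y\preceq x\preceq a$ and $0$ otherwise. (2) $P_{a)}$: $P_{a)}(x)=k$ if $x\preceq a$ and $x<a$, and $0$ otherwise; $P_{a)}(x,y)=1_k$ if $y\preceq x\preceq a$ and $y\le x<a$, and $0$ otherwise. (3) $P_{(a}$: $P_{(a}(x)=k$ if $x\preceq a$ and $a<x$, and $0$ otherwise; $P_{(a}(x,y)=1_k$ if $y\preceq x\preceq a$ and $a<x\le y$, and $0$ otherwise.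
   Context: A quiver of continuous type $A$, $A_{\mathbb R}=(\mathbb R,S,\preceq)$: $S\subset\mathbb R$ is a discrete, possibly empty, subset with no accumulation points; $\bar S=S\cup\{\pm\infty\}$ with $-\infty<s<+\infty$ for $s\in S$. Elements of $\bar S$ are indexed in an order-preserving way by a subset of $\mathbb Z\cup\{\pm\infty\}$ such that the index $0$ is used, and if $m\le p\le n$ in $\mathbb Z\cup\{\pm\infty\}$ and the indices $m,n$ are used then so is $p$ (so neighbours in $\bar S$ have consecutive integer indices; if $S$ is bounded above, $+\infty$ has an integer index, otherwise $+\infty=s_{+\infty}$; similarly for $-\infty$). The partial order $\preceq$ on $\mathbb R$: $x\preceq y$ iff $x=y$ or there are consecutive $s_n,s_{n+1}\in\bar S$ with $s_n\le x,y\le s_{n+1}$ and [$x\le y$ if $n$ is even; $y\le x$ if $n$ is odd]. So $s_n$ is a sink for $n$ even and a source for $n$ odd. The relation $x\preceq a$ for $x\in\mathbb R$, $a=\pm\infty$ is defined by the same rule: $x\preceq+\infty$ iff $+\infty=s_{n+1}$ for an even integer $n$ and $s_n\le x$; $x\preceq-\infty$ iff $-\infty=s_n$ for an odd integer $n$ and $x\le s_{n+1}$. A representation $V$ of $A_{\mathbb R}$ over $k$ assigns to each $x\in\mathbb R$ a $k$-vector space $V(x)$ and to each pair $y\preceq x$ a linear map $V(x,y):V(x)\to V(y)$ with $V(x,x)=\mathrm{id}$ and $V(y,z)\circ V(x,y)=V(x,z)$ for $z\preceq y\preceq x$. Morphisms are families of linear maps $f(x):V(x)\to W(x)$ commuting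 with the structure maps. $\mathrm{Rep}_k^{\mathrm{pwf}}(A_{\mathbb R})$ is the full subcategory of those $V$ with $\dim V(x)<\infty$ for all $x\in\mathbb R$; it is abelian with kernels and cokernels computed pointwise. Indecomposable objects are nonzero. *)

(* Defs.v *)
From HB Require Import structures.
From mathcomp Require Import all_boot all_order all_algebra zify.
From mathcomp Require Import boolp classical_sets reals ereal topology normedtype.
Set Implicit Arguments.
Unset Strict Implicit.
Unset Printing Implicit Defensive.
Import Order.TTheory GRing.Theory Num.Theory.
Import numFieldNormedType.Exports.
Local Open Scope classical_set_scope.
Local Open Scope ring_scope.

(* [qidx] is the set of indices in use and [qs n] is the element of index [n]
   of S together with the two infinities; the values of [qs] outside [qidx]
   are irrelevant.  A subset of the line without limit points is discrete. *)
Record quiverA (R : realType) := QuiverA {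
  qS : set R;
  qidx : set (\bar int);
  qs : \bar int -> \bar R;
  qS_limit_point : limit_point qS = set0;
  qs_image : qs @` qidx = (EFin @` qS) `|` [set -oo; +oo]%E;
  qs_lt : forall m n, qidx m -> qidx n -> (m < n)%E -> (qs m < qs n)%E;
  qidx0 : qidx 0%:E;
  qidx_convex : forall m p n, qidx m -> qidx n -> (m <= p <= n)%E -> qidx p }.

Section Prec.
Context {R : realType} (Q : quiverA R).
Implicit Types (x y z a : \bar R) (n m : int).

(* The order on the line, extended by the same rule to infinite arguments. *)
Definition prec x y : bool := `[< x = y \/ exists n : int,
  [/\ qidx Q n%:E, qidx Q (n + 1)%:E,
      (qs Q n%:E <= x <= qs Q (n + 1)%:E)%E,
      (qs Q n%:E <= y <= qs Q (n + 1)%:E)%E &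
      if (2 %| n)%Z then (x <= y)%E else (y <= x)%E] >].

Lemma prec_refl x : prec x x.
Proof. by apply/asboolP; left. Qed.

Lemma qs_le m n : qidx Q m%:E -> qidx Q n%:E -> (m <= n)%R ->
  (qs Q m%:E <= qs Q n%:E)%E.
Proof.
move=> Im In; rewrite le_eqVlt => /orP[/eqP->//|mn].
by apply/ltW/qs_lt => //; rewrite lte_fin.
Qed.

Lemma qs_inj m n : qidx Q m%:E -> qidx Q n%:E -> qs Q m%:E = qs Q n%:E -> m = n.
Proof.
move=> Im In e; case: (ltgtP m n) => // h.
- by have := @qs_lt _ Q m%:E n%:E Im In; rewrite lte_fin e ltxx => /(_ h).
- by have := @qs_lt _ Q n%:E m%:E In Im; rewrite lte_fin e ltxx => /(_ h).
Qed.

Lemma qs_adjacent m n y : (m < n)%R ->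
  qidx Q (m + 1)%:E -> qidx Q n%:E ->
  (y <= qs Q (m + 1)%:E)%E -> (qs Q n%:E <= y)%E ->
  [/\ qs Q (m + 1)%:E = y, qs Q n%:E = y & (2 %| n)%Z = ~~ (2 %| m)%Z].
Proof.
move=> mn Im1 In ym ny.
have le1 : (qs Q (m + 1)%:E <= qs Q n%:E)%E by apply: qs_le; rewrite ?lezD1.
have e : y = qs Q n%:E by apply/le_anti; rewrite ny (le_trans ym).
have nm : n = m + 1.
  by apply: qs_inj => //; apply/le_anti; rewrite le1 -e ym.
by rewrite -nm e nm; split=> //; lia.
Qed.

Lemma prec_chain x y z : prec z y -> prec y x -> [\/ z = y, y = x |
  exists n : int, [/\ qidx Q n%:E, qidx Q (n + 1)%:E,
      (qs Q n%:E <= z <= qs Q (n + 1)%:E)%E,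
      (qs Q n%:E <= x <= qs Q (n + 1)%:E)%E &
      if (2 %| n)%Z then (z <= y <= x)%E else (x <= y <= z)%E]].
Proof.
move=> /asboolP[->|[m [Im Im1 /andP[mz zm] /andP[my ym] zy]]]; first by constructor 1.
move=> /asboolP[->|[n [In In1 /andP[ny yn] /andP[nx xn] yx]]]; first by constructor 2.
case: (ltgtP m n) => mn.
- have [e1 e2 p] := qs_adjacent mn Im1 In ym ny.
  move: p zy yx; rewrite e1 in zm; rewrite e2 in nx.
  case: (2 %| m)%Z => /= -> zy yx.
  + by constructor 2; apply/le_anti; rewrite yx nx.
  + by constructor 1; apply/le_anti; rewrite zy zm.
- have [e1 e2 p] := qs_adjacent mn In1 Im yn my.
  move: p zy yx; rewrite e1 in xn; rewrite e2 in mz.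
  case: (2 %| n)%Z => /= -> zy yx.
  + by constructor 2; apply/le_anti; rewrite yx xn.
  + by constructor 1; apply/le_anti; rewrite zy mz.
- subst n; constructor 3; exists m; rewrite mz zm nx xn; split=> //.
  by move: zy yx; case: ifP => _ -> ->.
Qed.

Lemma prec_trans x y z : prec z y -> prec y x -> prec z x.
Proof.
move=> zy yx; case: (prec_chain zy yx) => [->//|<-//|[n [In In1 nz nx h]]].
apply/asboolP; right; exists n; rewrite nz nx; split=> //.
by move: h; case: ifP => _ /andP[h1 h2]; apply: le_trans h1 h2.
Qed.

Lemma prec_le_lt x y a : prec y x -> prec x a -> (x < a)%E -> (y <= x)%E.
Proof.
move=> yx xa ltxa; case: (prec_chain yx xa) => [->//|e|[n [_ _ _ _]]].
  by rewrite e ltxx in ltxa.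
by case: ifP => _ /andP[// ax _]; rewrite leNgt ltxa in ax.
Qed.

Lemma prec_le_gt x y a : prec y x -> prec x a -> (a < x)%E -> (x <= y)%E.
Proof.
move=> yx xa ltax; case: (prec_chain yx xa) => [->//|e|[n [_ _ _ _]]].
  by rewrite e ltxx in ltax.
by case: ifP => _ /andP[//_ xa']; rewrite leNgt ltax in xa'.
Qed.

End Prec.

Section Rep.
Context {R : realType} (k : fieldType) (Q : quiverA R).

(* Pointwise finite-dimensional representations: a [vectType] is a
   finite-dimensional vector space. *)
Record rep := Rep {
  rep_obj :> R -> vectType k;
  rep_map : forall x y : R, prec Q y%:E x%:E -> 'Hom(rep_obj x, rep_obj y);
  rep_id : forall (x : R) (xx : prec Q x%:E x%:E), rep_map xx = \1%VF;
  rep_comp : forall (x y z : R) (yx : prec Q y%:E x%:E)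
    (zy : prec Q z%:E y%:E) (zx : prec Q z%:E x%:E),
    (rep_map zy \o rep_map yx)%VF = rep_map zx }.

Record rep_hom (V W : rep) := RepHom {
  hom_at :> forall x : R, 'Hom(V x, W x);
  hom_nat : forall (x y : R) (yx : prec Q y%:E x%:E),
    (hom_at y \o rep_map V yx)%VF = (rep_map W yx \o hom_at x)%VF }.

Definition rep_iso (V W : rep) : Prop :=
  exists (f : rep_hom V W) (g : rep_hom W V),
    forall x, (g x \o f x)%VF = \1%VF /\ (f x \o g x)%VF = \1%VF.

Definition rep_zero (V : rep) : Prop := forall (x : R) (v : V x), v = 0.

Section DirectSum.
Variables V W : rep.

Definition dsum_fun (x y : R) (yx : prec Q y%:E x%:E) (p : V x * W x) :
  V y * W y := (rep_map V yx p.1, rep_map W yx p.2).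

Lemma dsum_fun_linear x y yx : linear (@dsum_fun x y yx).
Proof. by move=> a [u1 u2] [v1 v2]; rewrite /dsum_fun /= !linearP. Qed.

HB.instance Definition _ x y yx :=
  GRing.isLinear.Build k (V x * W x)%type (V y * W y)%type *:%R
    (@dsum_fun x y yx) (@dsum_fun_linear x y yx).

Lemma dsum_id (x : R) (xx : prec Q x%:E x%:E) :
  linfun (@dsum_fun x x xx) = \1%VF.
Proof.
by apply/lfunP => -[u v]; rewrite !lfunE /= /dsum_fun !rep_id !id_lfunE.
Qed.

Lemma dsum_comp (x y z : R) (yx : prec Q y%:E x%:E) (zy : prec Q z%:E y%:E)
    (zx : prec Q z%:E x%:E) :
  (linfun (@dsum_fun y z zy) \o linfun (@dsum_fun x y yx))%VF =
  linfun (@dsum_fun x z zx).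
Proof.
apply/lfunP => -[u v]; rewrite comp_lfunE !lfunE /= /dsum_fun /=.
by rewrite -(rep_comp V yx zy zx) -(rep_comp W yx zy zx) !comp_lfunE.
Qed.

Definition rep_dsum : rep :=
  @Rep (fun x => (V x * W x)%type : vectType k)
    (fun x y yx => linfun (@dsum_fun x y yx)) dsum_id dsum_comp.

End DirectSum.

Definition indecomposable (V : rep) : Prop :=
  ~ rep_zero V /\
  forall V1 V2 : rep, rep_iso V (rep_dsum V1 V2) -> rep_zero V1 \/ rep_zero V2.

Definition rep_epi (V W : rep) (f : rep_hom V W) : Prop :=
  forall (Z : rep) (g h : rep_hom W Z),
    (forall x, (g x \o f x)%VF = (h x \o f x)%VF) -> forall x, g x = h x.

Definition projective (P : rep) : Prop :=
  forall (V W : rep) (p : rep_hom V W) (f : rep_hom P W), rep_epi p ->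
    exists g : rep_hom P V, forall x, (p x \o g x)%VF = f x.

(* The map k -> k, or to or from the zero space, that is the identity if [c]
   holds and 0 otherwise; for [b : bool] the space ['rV[k]_b] is k or 0. *)
Definition unit_map (b b' c : bool) : 'Hom('rV[k]_b, 'rV[k]_b') :=
  linfun (mulmxr (const_mx c%:R : 'M[k]_(b, b'))).

Lemma unit_map_id b : unit_map b b b = \1%VF.
Proof.
apply/lfunP => v; rewrite id_lfunE lfunE /=; case: b v => v.
  by apply/rowP => i; rewrite !mxE big_ord1 !mxE !ord1 mulr1.
by rewrite [LHS]thinmx0 [RHS]thinmx0.
Qed.

Lemma unit_map_comp (b1 b2 b3 : bool) : (b1 -> b2) ->
  (unit_map b2 b3 b2 \o unit_map b1 b2 b1)%VF = unit_map b1 b3 b1.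
Proof.
move=> b12; apply/lfunP => v; rewrite comp_lfunE !lfunE /= -mulmxA; congr (_ *m _).
apply/matrixP => i j; rewrite !mxE; case: b1 b12 v i => [/(_ isT)-> v i|_ v []//].
by rewrite big_ord1 !mxE mulr1.
Qed.

Section Thin.
Variables (I : pred R) (c : rel R).
Hypothesis Idown : forall x y : R, prec Q y%:E x%:E -> I x -> I y.
Hypothesis cE : forall x y : R, prec Q y%:E x%:E -> c x y = I x.

Lemma thin_id (x : R) : prec Q x%:E x%:E ->
  unit_map (I x) (I x) (c x x) = \1%VF.
Proof. by move=> xx; rewrite cE// unit_map_id. Qed.

Lemma thin_comp (x y z : R) :
  prec Q y%:E x%:E -> prec Q z%:E y%:E -> prec Q z%:E x%:E ->
  (unit_map (I y) (I z) (c y z) \o unit_map (I x) (I y) (c x y))%VF =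
  unit_map (I x) (I z) (c x z).
Proof. by move=> yx zy zx; rewrite !cE// unit_map_comp//; apply: Idown. Qed.

Definition thin_rep : rep :=
  @Rep (fun x => 'rV[k]_(I x) : vectType k)
    (fun x y _ => unit_map (I x) (I y) (c x y)) thin_id thin_comp.

End Thin.

Section Projectives.
Implicit Types x y : R.

Definition P_at_supp (a : R) : pred R := fun x => prec Q x%:E a%:E.
Definition P_at_one (a : R) : rel R := fun x y =>
  prec Q y%:E x%:E && prec Q x%:E a%:E.

(* P_a) and P_(a : the parts of P_a strictly to the left and right of [a]. *)
Definition P_left_supp (a : \bar R) : pred R := fun x =>
  prec Q x%:E a && (x%:E < a)%E.
Definition P_left_one (a : \bar R) : rel R := fun x y =>
  [&& prec Q y%:E x%:E, prec Q x%:E a, y <= x & (x%:E < a)%E].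

Definition P_right_supp (a : \bar R) : pred R := fun x =>
  prec Q x%:E a && (a < x%:E)%E.
Definition P_right_one (a : \bar R) : rel R := fun x y =>
  [&& prec Q y%:E x%:E, prec Q x%:E a, (a < x%:E)%E & x <= y].

Lemma P_at_down a x y : prec Q y%:E x%:E -> P_at_supp a x -> P_at_supp a y.
Proof. exact: prec_trans. Qed.

Lemma P_at_oneE a x y : prec Q y%:E x%:E -> P_at_one a x y = P_at_supp a x.
Proof. by rewrite /P_at_one => ->. Qed.

Lemma P_left_down a x y :
  prec Q y%:E x%:E -> P_left_supp a x -> P_left_supp a y.
Proof.
move=> yx /andP[xa ltxa]; rewrite /P_left_supp (prec_trans yx xa) /=.
exact: le_lt_trans (prec_le_lt yx xa ltxa) ltxa.
Qed.

Lemma P_left_oneE a x y :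
  prec Q y%:E x%:E -> P_left_one a x y = P_left_supp a x.
Proof.
rewrite /P_left_one /P_left_supp => yx; rewrite yx /=.
case: (boolP (prec Q x%:E a)) => //= xa; apply/andP/idP => [[]//|ltxa].
by split=> //; rewrite -lee_fin (prec_le_lt yx xa ltxa).
Qed.

Lemma P_right_down a x y :
  prec Q y%:E x%:E -> P_right_supp a x -> P_right_supp a y.
Proof.
move=> yx /andP[xa ltax]; rewrite /P_right_supp (prec_trans yx xa) /=.
exact: lt_le_trans ltax (prec_le_gt yx xa ltax).
Qed.

Lemma P_right_oneE a x y :
  prec Q y%:E x%:E -> P_right_one a x y = P_right_supp a x.
Proof.
rewrite /P_right_one /P_right_supp => yx; rewrite yx /=.
case: (boolP (prec Q x%:E a)) => //= xa; apply/andP/idP => [[]//|ltax].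
by split=> //; rewrite -lee_fin (prec_le_gt yx xa ltax).
Qed.

Definition P_at (a : R) : rep := thin_rep (@P_at_down a) (@P_at_oneE a).
Definition P_left (a : \bar R) : rep :=
  thin_rep (@P_left_down a) (@P_left_oneE a).
Definition P_right (a : \bar R) : rep :=
  thin_rep (@P_right_down a) (@P_right_oneE a).

End Projectives.

End Rep.

(* Main.v *)
From HB Require Import structures.
Require Import Defs.
From mathcomp Require Import all_boot all_order all_algebra.
From mathcomp Require Import boolp classical_sets reals ereal topology normedtype.

(* Mapping V to thin representations supported on up-sets shows that the
   structure maps of a projective V are injective.  Choose x0 with V(x0)
   nonzero such that U = {x | x0 precedes x and V(x, x0) <> 0} is a chain.  By
   finite-dimensionality some nonzero w in V(x0) lies in the image of V(x, x0)
   for every x in U.  A functional on V(x0) with value 1 at w gives a map from V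
   to the thin representation on U, which is a quotient of the thin
   representation T on the down-set D generated by U; projectivity lifts it to
   V -> T.  By injectivity w has unique preimages over U, and they define a
   section T -> V.  So T is a summand of V, hence V is isomorphic to T.  Finally
   D is the support of P_a, P_a) or P_(a according to whether U has a greatest
   element a, or has none and converges to a from the left or from the right. *)

Set Implicit Arguments.
Unset Strict Implicit.
Unset Printing Implicit Defensive.
Import Order.TTheory GRing.Theory Num.Theory.
Local Open Scope ring_scope.

(** * Arcs between neighbours in the order *)

Section Order.
Context {R : realType} (Q : quiverA R).
Implicit Types (x y z a : \bar R) (n m : int).

Definition qarc n x := [/\ qidx Q n%:E, qidx Q (n + 1)%:E &
  (qs Q n%:E <= x <= qs Q (n + 1)%:E)%E].

(** Distinct arcs meet at most in the upper end of the left one, so [x] and [y] both equal that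
    end. *)
Lemma qarc_lt m n x y : (m < n)%R -> qarc m x -> qarc m y -> qarc n x ->
  qarc n y -> x = y.
Proof.
move=> mn [_ Im /andP[_ xm]] [_ _ /andP[_ ym]] [In _ /andP[nx _]] [_ _ /andP[ny _]].
have [<- _ _] := qs_adjacent mn Im In xm nx.
by have [<- _ _] := qs_adjacent mn Im In ym ny.
Qed.

Lemma qarc_inj m n x y : x <> y -> qarc m x -> qarc m y -> qarc n x ->
  qarc n y -> m = n.
Proof.
by move=> xy mx my nx ny; case: (ltgtP m n) => // h; case: xy;
  [apply: qarc_lt h _ _ _ _ | apply: qarc_lt h _ _ _ _].
Qed.

Lemma precP x y : reflect
  (x = y \/ exists n, [/\ qarc n x, qarc n y &
    if (2 %| n)%Z then (x <= y)%E else (y <= x)%E]) (prec Q x y).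
Proof.
apply: (iffP (asboolP _)) => -[]; [by left| |by left|].
- by case=> n [*]; right; exists n.
- by case=> n [[? ? ?] [? ? ?] ?]; right; exists n.
Qed.

Lemma prec_qarc n x y : qarc n x -> qarc n y ->
  (if (2 %| n)%Z then (x <= y)%E else (y <= x)%E) -> prec Q x y.
Proof. by move=> nx ny h; apply/precP; right; exists n. Qed.

Lemma prec_total_qarc n x y : qarc n x -> qarc n y -> prec Q x y \/ prec Q y x.
Proof.
move=> nx ny; have [xy|yx] := leP x y.
- case: (boolP (2 %| n)%Z) => h; [left|right];
    by apply: (prec_qarc (n := n)) => //; rewrite ?h ?(negbTE h).
- case: (boolP (2 %| n)%Z) => h; [right|left];
    by apply: (prec_qarc (n := n)) => //; rewrite ?h ?(negbTE h) ltW.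
Qed.

(** Arcs meet only at sinks and sources: [y] is not minimal, hence no sink, and a source has nothing
    but itself above it. *)
Lemma prec_strict_qarc x y z : x <> y -> prec Q x y -> prec Q y z ->
  exists n, [/\ qarc n x, qarc n y & qarc n z].
Proof.
move=> xy xy' yz; case: (prec_chain xy' yz) => // [e|].
  move: xy'; rewrite e => /precP[//|[n [? ? _]]]; first by rewrite -e.
  by exists n.
move=> [n [In In1 xn zn h]]; exists n; split=> //; split=> //.
move: xn zn h => /andP[nx xn] /andP[nz zn].
case: ifP => _ /andP[h1 h2]; apply/andP; split.
- exact: le_trans h1.
- exact: le_trans zn.
- exact: le_trans h1.
- exact: le_trans xn.
Qed.

(** The distinct points [x] and [y] single out one arc, on which the order is total. Above a sink
    two arcs are available, hence the point [x] strictly below [y]. *)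
Lemma prec_up_total x y z z' : x <> y -> prec Q x y -> prec Q y z ->
  prec Q y z' -> prec Q z z' \/ prec Q z' z.
Proof.
move=> nxy xy yz yz'.
have [n [nx ny nz]] := prec_strict_qarc nxy xy yz.
have [m [mx my mz]] := prec_strict_qarc nxy xy yz'.
by move: mz; rewrite -(qarc_inj nxy nx ny mx my); apply: prec_total_qarc.
Qed.

End Order.

(** * The down-set generated by a chain without greatest element *)

Section Shape.
Context {R : realType} (Q : quiverA R).
Implicit Types (x y z u : R).

Variables (x0 : R) (U : set R).
Hypothesis U0 : U x0.
Hypothesis Ule : forall x, U x -> prec Q x0%:E x%:E.
Hypothesis Utotal : forall x y, U x -> U y ->
  prec Q x%:E y%:E \/ prec Q y%:E x%:E.
Hypothesis Unomax : forall x, U x -> exists2 y, U y & ~ prec Q y%:E x%:E.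

(** Having no greatest element, [U] contains a point [x] other than [x0], and the two determine the
    arc. Any further point is comparable with [x], which keeps it on that arc. *)
Lemma nomax_qarc : exists n, forall x, U x -> qarc Q n x%:E.
Proof.
have [x Ux nx] := Unomax U0.
have nx0 : x0%:E <> x%:E by move=> e; apply: nx; rewrite e prec_refl.
have [n [n0 nx' _]] := prec_strict_qarc nx0 (Ule Ux) (prec_refl Q x%:E).
exists n => y Uy; case: (Utotal Ux Uy) => [xy|yx].
- have [m [m0 mx my]] := prec_strict_qarc nx0 (Ule Ux) xy.
  by rewrite (qarc_inj nx0 n0 nx' m0 mx).
- have [e|ne] := pselect (x0%:E = y%:E :> \bar R); first by rewrite -e.
  have [m [m0 my mx]] := prec_strict_qarc ne (Ule Uy) yx.
  by rewrite (qarc_inj nx0 n0 nx' m0 mx).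
Qed.

(** On an even arc the order is that of the line, so [U] approaches its supremum [a] from the left;
    on an odd arc it is reversed and [a] is the infimum. Either may be infinite. *)
Lemma nomax_shape :
  (exists a, forall z, P_left_supp Q a z <-> exists2 u, U u & prec Q z%:E u%:E) \/
  (exists a, forall z, P_right_supp Q a z <-> exists2 u, U u & prec Q z%:E u%:E).
Proof.
have [n nU] := nomax_qarc.
have [In In1 _] := nU _ U0.
case: (boolP (2 %| n)%Z) => pn; [left|right].
- set a := ereal_sup (EFin @` U)%classic.
  have Ua u : U u -> (u%:E <= a)%E by move=> Uu; apply: ereal_sup_ubound; exists u.
  have na : qarc Q n a.
    split=> //; apply/andP; split.
      by apply: le_trans (Ua _ U0); have [_ _ /andP[]] := nU _ U0.
    by apply: ge_ereal_sup => _ [u Uu <-]; have [_ _ /andP[]] := nU _ Uu.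
  exists a => z; split=> [/andP[za ltza]|[u Uu zu]].
    have [_ [u Uu <-] ltzu] := ereal_sup_gt ltza.
    (* The arc [m] carrying [z] and [a] also contains [u], which lies between them, so [m] need not
       be compared with [n]. *)
    exists u => //; case/precP: za => [e|[m [[Im Im1 /andP[mz _]] [_ _ /andP[_ am]]]]].
      by rewrite e ltxx in ltza.
    case: ifP => pm; last by rewrite leNgt ltza.
    move=> _; apply: (prec_qarc (n := m)); last by rewrite pm ltW.
      by split=> //; rewrite mz (le_trans (ltW ltza)).
    by split=> //; rewrite (le_trans mz (ltW ltzu)) (le_trans (Ua _ Uu)).
  have [v Uv vu] := Unomax Uu.
  (* The point [v] lies to the right of [u], so the supremum is not attained. *)
  have ltua : (u%:E < a)%E.
    apply: lt_le_trans (Ua _ Uv); rewrite ltNge; apply/negP => vu'; apply: vu.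
    by apply: (prec_qarc (n := n)) => //; [exact: nU|exact: nU|rewrite pn].
  have ua : prec Q u%:E a by apply: (prec_qarc (n := n)) => //; [exact: nU|rewrite pn ltW].
  rewrite /P_left_supp (prec_trans zu ua) /=.
  exact: le_lt_trans (prec_le_lt zu ua ltua) ltua.
- set a := ereal_inf (EFin @` U)%classic.
  have Ua u : U u -> (a <= u%:E)%E by move=> Uu; apply: ereal_inf_lbound; exists u.
  have na : qarc Q n a.
    split=> //; apply/andP; split.
      by apply: le_ereal_inf_tmp => _ [u Uu <-]; have [_ _ /andP[]] := nU _ Uu.
    by apply: (le_trans (Ua _ U0)); have [_ _ /andP[]] := nU _ U0.
  exists a => z; split=> [/andP[za ltza]|[u Uu zu]].
    have [_ [u Uu <-] ltzu] := ereal_inf_lt ltza.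
    exists u => //; case/precP: za => [e|[m [[Im Im1 /andP[_ zm]] [_ _ /andP[ma _]]]]].
      by rewrite e ltxx in ltza.
    case: ifP => pm; first by rewrite leNgt ltza.
    move=> _; apply: (prec_qarc (n := m)); last by rewrite pm ltW.
      by split=> //; rewrite zm (le_trans ma (ltW ltza)).
    by split=> //; rewrite (le_trans (ltW ltzu)) // (le_trans ma (Ua _ Uu)).
  have [v Uv vu] := Unomax Uu.
  have ltua : (a < u%:E)%E.
    apply: le_lt_trans (Ua _ Uv) _; rewrite ltNge; apply/negP => vu'; apply: vu.
    by apply: (prec_qarc (n := n)) => //; [exact: nU|exact: nU|rewrite (negbTE pn)].
  have ua : prec Q u%:E a.
    by apply: (prec_qarc (n := n)) => //; [exact: nU|rewrite (negbTE pn) ltW].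
  rewrite /P_right_supp (prec_trans zu ua) /=.
  exact: lt_le_trans ltua (prec_le_gt zu ua ltua).
Qed.

End Shape.

(** * Linear algebra on the spaces k and 0 *)

Section UnitMap.
Context {k : fieldType}.

(* For [b = true], the identification of ['rV_1] with the field. *)
Definition rV_scalar (b : bool) (v : 'rV[k]_b) : k := \sum_j v 0 j.

Lemma rV_scalar_const (b : bool) (c : k) : b -> rV_scalar (const_mx c : 'rV[k]_b) = c.
Proof. by case: b => // _; rewrite /rV_scalar big_ord1 mxE. Qed.

Lemma rV_scalar_inj (b : bool) (v w : 'rV[k]_b) :
  (b -> rV_scalar v = rV_scalar w) -> v = w.
Proof.
case: b v w => v w; last by move=> _; rewrite [v]thinmx0 [w]thinmx0.
by move=> /(_ isT); rewrite /rV_scalar !big_ord1 => e; apply/rowP => i; rewrite ord1.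
Qed.

Lemma rV_scalar_is_linear (b : bool) : linear (@rV_scalar b : 'rV[k]_b -> k^o).
Proof.
move=> a v w; rewrite /rV_scalar scaler_sumr -big_split /=.
by apply: eq_bigr => i _; rewrite !mxE.
Qed.

Lemma rV_scalarZ (b : bool) (a : k) (v : 'rV[k]_b) :
  rV_scalar (a *: v) = a * rV_scalar v.
Proof. by rewrite /rV_scalar mulr_sumr; apply: eq_bigr => i _; rewrite mxE. Qed.

Lemma rV_scalar_unit_map (b b' c : bool) (v : 'rV[k]_b) : (b -> c) -> b' ->
  rV_scalar (unit_map k b b' c v) = rV_scalar v.
Proof.
case: b' => // h _; rewrite lfunE /rV_scalar big_ord1 mxE; apply: eq_bigr => i _.
by case: b h i v => [/(_ isT)-> i v|_ []//]; rewrite mxE mulr1.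
Qed.

Lemma functional_neq0 (W : vectType k) (w : W) : w <> 0 ->
  exists phi : 'Hom(W, k^o), phi w = 1.
Proof.
move=> w0.
have [i ci] : exists i, coord (vbasis fullv) i w != 0.
  apply/existsP; apply: contra_notT w0 => /existsPn h.
  rewrite (coord_vbasis (memvf w)) big1// => i _.
  by move: (h i); rewrite negbK => /eqP->; rewrite scale0r.
exists ((coord (vbasis fullv) i w)^-1 *: linfun (coord (vbasis fullv) i : W -> k^o)).
by rewrite scale_lfunE lfunE /= /GRing.scale /= mulVf.
Qed.

End UnitMap.

(** * Representations and morphisms on vectors *)

Section Reps.
Context {R : realType} (k : fieldType) (Q : quiverA R).
Implicit Types (V W : rep k Q) (x y z : R).

(* A total version of [rep_map], sparing its proof argument. *)
Definition smap V x y : 'Hom(V x, V y) :=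
  match @idP (prec Q y%:E x%:E) with
  | ReflectT yx => rep_map V yx
  | ReflectF _ => 0
  end.

Lemma smapE V x y (yx : prec Q y%:E x%:E) : smap V x y = rep_map V yx.
Proof.
rewrite /smap; case: {-}_ / idP => // h.
by congr (rep_map V _); apply: bool_irrelevance.
Qed.

Lemma smap_id V x v : smap V x x v = v.
Proof. by rewrite (smapE V (prec_refl Q x%:E)) rep_id id_lfunE. Qed.

Lemma smap_comp V x y z v : prec Q y%:E x%:E -> prec Q z%:E y%:E ->
  smap V y z (smap V x y v) = smap V x z v.
Proof.
move=> yx zy; rewrite (smapE V yx) (smapE V zy) (smapE V (prec_trans zy yx)).
by rewrite -(rep_comp V yx zy (prec_trans zy yx)) comp_lfunE.
Qed.

Lemma hom_natE V W (f : rep_hom V W) x y v : prec Q y%:E x%:E ->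
  f y (smap V x y v) = smap W x y (f x v).
Proof.
by move=> yx; rewrite !(smapE _ yx) -[LHS]comp_lfunE hom_nat comp_lfunE.
Qed.

Lemma rep_hom_exists V W (f : forall x, V x -> W x) :
  (forall x, linear (f x)) ->
  (forall x y v, prec Q y%:E x%:E -> f y (smap V x y v) = smap W x y (f x v)) ->
  exists g : rep_hom V W, forall x v, g x v = f x v.
Proof.
move=> flin fnat.
pose F x : {linear V x -> W x} :=
  HB.pack (f x) (GRing.isLinear.Build k (V x) (W x) *:%R (f x) (flin x)).
suff h x y (yx : prec Q y%:E x%:E) :
    (linfun (F y) \o rep_map V yx)%VF = (rep_map W yx \o linfun (F x))%VF.
  by exists (RepHom h) => x v; rewrite lfunE.
by apply/lfunP => v; rewrite !comp_lfunE -!smapE !lfunE; apply: fnat.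
Qed.

Lemma surjective_epi V W (f : rep_hom V W) :
  (forall x w, exists v, f x v = w) -> rep_epi f.
Proof.
move=> fs Z g h gh x; apply/lfunP => w; have [v <-] := fs x w.
by rewrite -!comp_lfunE gh.
Qed.

(** * Thin representations on convex sets, and lifting to them *)

Definition convex (I : pred R) := forall x y z,
  prec Q y%:E x%:E -> prec Q z%:E y%:E -> I x -> I z -> I y.

Section Convex.
Variable I : pred R.
Hypothesis Iconvex : convex I.

Lemma convex_id x : prec Q x%:E x%:E -> unit_map k (I x) (I x) true = \1%VF.
Proof.
move=> _; apply/lfunP => v; apply: rV_scalar_inj => Ix.
by rewrite rV_scalar_unit_map// id_lfunE.
Qed.

Lemma convex_comp x y z :
  prec Q y%:E x%:E -> prec Q z%:E y%:E -> prec Q z%:E x%:E ->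
  (unit_map k (I y) (I z) true \o unit_map k (I x) (I y) true)%VF =
  unit_map k (I x) (I z) true.
Proof.
move=> yx zy zx; apply/lfunP => v; apply: rV_scalar_inj => Iz.
rewrite comp_lfunE; case: (boolP (I x)) v => [Ix v|_ v].
  by rewrite !rV_scalar_unit_map// (Iconvex yx zy).
by rewrite [v]thinmx0 !linear0.
Qed.

(** Unlike in [thin_rep] the support need not be a down-set; convexity keeps a composite from
    vanishing across a gap. The constant [true] is harmless, since maps from or to a zero space
    vanish. *)
Definition convex_rep : rep k Q :=
  @Rep R k Q (fun x => 'rV[k]_(I x) : vectType k)
    (fun x y _ => unit_map k (I x) (I y) true) convex_id convex_comp.

Lemma convex_smapE x y v : prec Q y%:E x%:E ->
  smap convex_rep x y v = unit_map k (I x) (I y) true v.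
Proof. by move=> yx; rewrite (smapE _ yx). Qed.

End Convex.

(** A map to a thin representation is a compatible family of functionals; over [I] they must kill
    whatever arrives from outside [I], whence the value 0. *)
Lemma functional_hom V (I : pred R) (HI : convex I)
    (phi : forall x, 'Hom(V x, k^o)) :
  (forall x y v, prec Q y%:E x%:E -> I y ->
    phi y (smap V x y v) = if I x then phi x v else 0) ->
  exists g : rep_hom V (convex_rep HI), forall x v, g x v = const_mx (phi x v).
Proof.
move=> phin; apply: (@rep_hom_exists V (convex_rep HI) (fun x v => const_mx (phi x v))).
  by move=> x a v w; apply/rowP => j; rewrite linearP !mxE.
move=> x y v yx; rewrite convex_smapE//; apply: rV_scalar_inj => Iy.
rewrite rV_scalar_const// rV_scalar_unit_map// phin//.
by case: ifP => Ix; rewrite /rV_scalar ?big_ord1 ?big_ord0 ?mxE.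
Qed.

(* As [J] is an upper part of [I], the thin representation on [J] is a quotient
   of the one on [I]. *)
Lemma lift_functional V (V_proj : projective V) x0 (phi : 'Hom(V x0, k^o))
    (I J : pred R) (HI : convex I) :
  (forall x, J x -> I x) ->
  (forall x y, prec Q y%:E x%:E -> I x -> J y -> J x) ->
  (forall x, J x -> prec Q x0%:E x%:E) ->
  (forall x v, prec Q x0%:E x%:E -> ~~ J x -> phi (smap V x x0 v) = 0) ->
  exists g : rep_hom V (convex_rep HI),
    forall x v, J x -> rV_scalar (g x v) = phi (smap V x x0 v).
Proof.
move=> JI Jup Jx0 phi0.
have HJ : convex J.
  move=> x y z yx zy Jx Jz.
  exact: (Jup _ _ zy (HI _ _ _ yx zy (JI _ Jx) (JI _ Jz)) Jz).
(* The map to the quotient is [phi] after transport to [x0]; vanishing of [phi] on what comes from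
   outside [J] makes it natural. *)
have [|h hE] := @functional_hom V J HJ (fun x => (phi \o smap V x x0)%VF).
  move=> x y v yx Jy; rewrite !comp_lfunE smap_comp ?Jx0//.
  by case: ifPn => // nJx; rewrite phi0// (prec_trans (Jx0 _ Jy)).
have [||p pE] := @rep_hom_exists (convex_rep HI) (convex_rep HJ)
  (fun x => unit_map k (I x) (J x) true).
- by move=> x a v w; rewrite linearP.
- move=> x y v yx; rewrite !convex_smapE//; apply: rV_scalar_inj => Jy.
  have Iy := JI _ Jy.
  have [Ix|/negP nIx] := orP (orbN (I x)); last first.
    by have -> : v = 0 by [apply: rV_scalar_inj => /nIx]; rewrite !linear0.
  by rewrite !rV_scalar_unit_map// (Jup x y).
have pepi : rep_epi p.
  apply: surjective_epi => x w; exists (unit_map k (J x) (I x) true w).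
  rewrite pE; apply: rV_scalar_inj => Jx.
  by rewrite !rV_scalar_unit_map// JI.
have [g pg] := V_proj _ _ p h pepi.
exists g => x v Jx.
have := congr1 (fun f : 'Hom(_, _) => rV_scalar (f v)) (pg x).
by rewrite comp_lfunE pE hE rV_scalar_const// comp_lfunE rV_scalar_unit_map.
Qed.

(** Lift a functional with value 1 at [v - w] to the thin representation on the points above [y].
    Its map from [x] to [y] is the identity, so [v - w] cannot die at [y]. *)
Lemma projective_inj V (V_proj : projective V) x y : prec Q y%:E x%:E ->
  injective (smap V x y).
Proof.
move=> yx v w e; apply: contrapT => vw.
have [phi phi1] : exists phi : 'Hom(V x, k^o), phi (v - w) = 1.
  by apply: functional_neq0 => /subr0_eq.
have HI : convex (fun z => prec Q y%:E z%:E).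
  by move=> a b c ba cb _ yc; apply: prec_trans yc cb.
have [||//||g gE] := @lift_functional V V_proj x phi _
    (fun z => prec Q x%:E z%:E) HI.
- by move=> z; apply: prec_trans.
- by move=> a b ba _ xb; apply: prec_trans xb ba.
- by move=> z u ->.
have := gE x (v - w) (prec_refl _ _).
rewrite smap_id phi1 => /eqP; apply/negP; rewrite eq_sym.
suff -> : g x (v - w) = 0 by rewrite /rV_scalar big1 ?oner_eq0// => i _; rewrite mxE.
apply: rV_scalar_inj => _.
have := hom_natE g (v - w) yx; rewrite linearB /= e subrr linear0 convex_smapE//.
move=> /(congr1 (@rV_scalar k _)); rewrite rV_scalar_unit_map ?prec_refl// => <-.
by rewrite /rV_scalar !big1// => i _; rewrite mxE.
Qed.

(** * Kernels, retracts and isomorphisms *)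

Section Kernel.
Variables (V W : rep k Q) (g : rep_hom V W).

Definition ker_map x y (yx : prec Q y%:E x%:E) :
    'Hom(subvs_of (lker (g x)), subvs_of (lker (g y))) :=
  (linfun (vsproj (lker (g y))) \o rep_map V yx \o linfun vsval)%VF.

Lemma ker_mapE x y (yx : prec Q y%:E x%:E) v :
  vsval (ker_map yx v) = rep_map V yx (vsval v).
Proof.
rewrite !comp_lfunE !lfunE /= vsprojK// memv_ker -comp_lfunE hom_nat comp_lfunE.
by have := subvsP v; rewrite memv_ker => /eqP ->; rewrite linear0.
Qed.

Lemma ker_id x (xx : prec Q x%:E x%:E) : ker_map xx = \1%VF.
Proof. by apply/lfunP => v; apply: val_inj; rewrite /= ker_mapE rep_id !id_lfunE. Qed.

Lemma ker_comp x y z (yx : prec Q y%:E x%:E) (zy : prec Q z%:E y%:E)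
  (zx : prec Q z%:E x%:E) : (ker_map zy \o ker_map yx)%VF = ker_map zx.
Proof.
apply/lfunP => v; apply: val_inj.
by rewrite /= comp_lfunE !ker_mapE -(rep_comp V yx zy zx) comp_lfunE.
Qed.

Definition rep_ker : rep k Q :=
  @Rep R k Q (fun x => subvs_of (lker (g x)) : vectType k) ker_map ker_id ker_comp.

Lemma ker_smapE x y v : prec Q y%:E x%:E ->
  vsval (smap rep_ker x y v) = smap V x y (vsval v).
Proof. by move=> yx; rewrite !(smapE _ yx) ker_mapE. Qed.

End Kernel.

Lemma dsum_smapE V W x y v : prec Q y%:E x%:E ->
  smap (rep_dsum V W) x y v = (smap V x y v.1, smap W x y v.2).
Proof. by move=> yx; rewrite !(smapE _ yx) lfunE. Qed.

(** Writing [v] as [f x (g x v)] plus a vector of the kernel of [g] identifies [V] with the sum of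
    [W] and that kernel. As [W] is nonzero, the kernel vanishes. *)
Lemma indecomposable_retract V W (f : rep_hom W V) (g : rep_hom V W) :
  indecomposable V -> ~ rep_zero W -> (forall x w, g x (f x w) = w) ->
  rep_iso V W.
Proof.
move=> [_ Vind] W0 gf.
have kerE x (v : V x) : v - f x (g x v) \in lker (g x).
  by rewrite memv_ker linearB /= gf subrr.
have [||a aE] := @rep_hom_exists V (rep_dsum W (rep_ker g))
    (fun x v => (g x v, vsproj (lker (g x)) (v - f x (g x v)))).
- move=> x c v w; rewrite linearP.
  have -> : c *: v + w - f x (c *: g x v + g x w) =
      c *: (v - f x (g x v)) + (w - f x (g x w)).
    by rewrite linearP scalerBr opprD addrACA.
  by rewrite linearP.
- move=> x y v yx; rewrite dsum_smapE// hom_natE//=; congr pair.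
  apply: val_inj; rewrite /= ker_smapE// !vsprojK ?kerE//; last first.
    by rewrite -(hom_natE g)// kerE.
  by rewrite linearB /= hom_natE.
have [||b bE] := @rep_hom_exists (rep_dsum W (rep_ker g)) V
    (fun x v => f x v.1 + vsval v.2).
- move=> x c v w /=; rewrite !linearP scalerDr.
  by rewrite addrACA.
- by move=> x y v yx; rewrite dsum_smapE//= hom_natE// ker_smapE// linearD.
have [//|ker0] : rep_zero W \/ rep_zero (rep_ker g).
  apply: Vind; exists a, b => x; split; apply/lfunP => v;
    rewrite comp_lfunE id_lfunE aE bE /=.
    by rewrite vsprojK ?kerE// subrKC.
  have gv2 : g x (vsval v.2) = 0 by apply/eqP; rewrite -memv_ker; apply: subvsP.
  case: v gv2 => v1 v2 /= gv2; rewrite linearD /= gf gv2 addr0 addrAC subrr add0r.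
  by rewrite vsvalK.
exists g, f => x; split; apply/lfunP => v; rewrite comp_lfunE id_lfunE ?gf//.
have := ker0 x (vsproj (lker (g x)) (v - f x (g x v))).
by move=> /(congr1 vsval); rewrite vsprojK ?kerE// => /subr0_eq/esym.
Qed.

Lemma rep_iso_trans V W X : rep_iso V W -> rep_iso W X -> rep_iso V X.
Proof.
move=> [f [g fg]] [f' [g' fg']].
have comp (A B C : rep k Q) (a : rep_hom A B) (b : rep_hom B C) :
    exists c : rep_hom A C, forall x v, c x v = b x (a x v).
  apply: (@rep_hom_exists A C (fun x v => b x (a x v))).
    by move=> x c v w; rewrite !linearP.
  by move=> x y v yx; rewrite !hom_natE.
have [h hE] := comp _ _ _ f f'; have [l lE] := comp _ _ _ g' g.
exists h, l => x; have [gf fg1] := fg x; have [gf' fg1'] := fg' x.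
split; apply/lfunP => v; rewrite comp_lfunE id_lfunE hE lE.
- by rewrite -[g' x _]comp_lfunE gf' id_lfunE -comp_lfunE gf id_lfunE.
- by rewrite -[f x _]comp_lfunE fg1 id_lfunE -comp_lfunE fg1' id_lfunE.
Qed.

(** The spaces coincide, and the constants [c x y] and [true] differ only where the source space is
    zero. *)
Lemma convex_rep_thin (I : pred R) (c : rel R) (HI : convex I)
    (Idown : forall x y, prec Q y%:E x%:E -> I x -> I y)
    (cE : forall x y, prec Q y%:E x%:E -> c x y = I x) :
  rep_iso (convex_rep HI) (thin_rep k Idown cE).
Proof.
have smapE' x y v : prec Q y%:E x%:E ->
    smap (thin_rep k Idown cE) x y v = smap (convex_rep HI) x y v.
  move=> yx; rewrite convex_smapE// (smapE _ yx) /= cE//.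
  by apply: rV_scalar_inj => Iy; rewrite !rV_scalar_unit_map.
have [||f fE] := @rep_hom_exists (convex_rep HI) (thin_rep k Idown cE) (fun x v => v).
- by [].
- by move=> x y v yx; rewrite smapE'.
have [||g gE] := @rep_hom_exists (thin_rep k Idown cE) (convex_rep HI) (fun x v => v).
- by [].
- by move=> x y v yx; rewrite smapE'.
by exists f, g => x; split; apply/lfunP => v; rewrite comp_lfunE id_lfunE fE gE.
Qed.

(** * The set [U] over a base point, here [up_supp], and the splitting of [V] *)

Definition up_supp V x0 : pred R := fun x =>
  prec Q x0%:E x%:E && (smap V x x0 != 0).

Lemma up_suppP V x0 x : up_supp V x0 x ->
  prec Q x0%:E x%:E /\ exists v, smap V x x0 v <> 0.
Proof.
move=> /andP[x0x ne]; split=> //; apply: contrapT => h; case/eqP: ne.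
by apply/lfunP => v; rewrite zero_lfunE; apply: contrapT => h'; apply: h; exists v.
Qed.

Lemma up_supp_base V x0 (v0 : V x0) : v0 <> 0 -> up_supp V x0 x0.
Proof.
move=> v00; rewrite /up_supp prec_refl /=; apply/eqP => h.
by apply: v00; rewrite -(smap_id v0) h zero_lfunE.
Qed.

(* By finite-dimensionality the decreasing images in [V x0] stabilize. *)
Lemma up_supp_common V x0 (v0 : V x0) : v0 <> 0 ->
  (forall x y, up_supp V x0 x -> up_supp V x0 y ->
     prec Q x%:E y%:E \/ prec Q y%:E x%:E) ->
  exists2 w : V x0, w <> 0 &
    forall x, up_supp V x0 x -> exists v, smap V x x0 v = w.
Proof.
move=> v00 Utot.
have U0 := up_supp_base v00.
pose P n := `[< exists2 u, up_supp V x0 u & \dim (limg (smap V u x0)) = n >].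
have exP : exists n, P n by exists (\dim (limg (smap V x0 x0))); apply/asboolP; exists x0.
case: (ex_minnP exP) => n /asboolP[u Uu dn] nmin.
have [ux0 [v v1]] := up_suppP Uu.
exists (smap V u x0 v) => // x Ux.
have [x0x _] := up_suppP Ux.
(* The image from [u] has least dimension. For [x] below [u] it factors through [x]; for [x] above
   [u] the image from [x] lies inside it, hence equals it. *)
case: (Utot _ _ Ux Uu) => [xu|ux].
  by exists (smap V u x v); rewrite smap_comp.
have sub : (limg (smap V x x0) <= limg (smap V u x0))%VS.
  apply/subvP => _ /memv_imgP[a _ ->]; rewrite -(smap_comp a ux ux0).
  by apply: memv_img; apply: memvf.
have eqI : limg (smap V x x0) = limg (smap V u x0).
  apply/eqP; rewrite eqEdim sub /= dn; apply: nmin.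
  by apply/asboolP; exists x.
have : smap V u x0 v \in limg (smap V x x0) by rewrite eqI memv_img// memvf.
by move=> /memv_imgP[a _ ->]; exists a.
Qed.

(** [D] and [c] stay general so that one argument serves all three families of projectives. *)
Lemma indecomposable_projective_thin V (V_indec : indecomposable V)
    (V_proj : projective V) x0 (v0 : V x0) (D : pred R) (c : rel R)
    (Ddown : forall x y, prec Q y%:E x%:E -> D x -> D y)
    (cE : forall x y, prec Q y%:E x%:E -> c x y = D x) :
  v0 <> 0 ->
  (forall x y, up_supp V x0 x -> up_supp V x0 y ->
     prec Q x%:E y%:E \/ prec Q y%:E x%:E) ->
  (forall z, D z <-> exists2 u, up_supp V x0 u & prec Q z%:E u%:E) ->
  rep_iso V (thin_rep k Ddown cE).
Proof.
move=> v00 Utot DE.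
have [w w0 wE] := up_supp_common v00 Utot.
have U0 := up_supp_base v00.
have D0 : D x0 by apply/DE; exists x0; rewrite ?prec_refl.
have HD : convex D by move=> x y z yx _ Dx _; apply: Ddown yx Dx.
apply: rep_iso_trans (convex_rep_thin HD Ddown cE).
have [phi phi1] := functional_neq0 w0.
have UD x : up_supp V x0 x -> D x by move=> Ux; apply/DE; exists x; rewrite ?prec_refl.
have [|||g gE] := @lift_functional V V_proj x0 phi D (up_supp V x0) HD UD.
(* For [x] below some [u] in [U], the nonzero map from [u] to [x0] factors through [x]. *)
- move=> x y yx /DE[u Uu xu] Uy; have [x0u [a a0]] := up_suppP Uu.
  have [x0y _] := up_suppP Uy; have x0x := prec_trans x0y yx.
  rewrite /up_supp x0x /=; apply/eqP => h; apply: a0.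
  by rewrite -(smap_comp a xu x0x) h zero_lfunE.
- by move=> x /andP[].
- move=> x v x0x; rewrite /up_supp x0x /= negbK => /eqP->.
  by rewrite zero_lfunE linear0.
(* The vector at [z] comes from the preimage of [w] over any [u] in [U] above [z]. Totality of [U]
   and injectivity make it independent of [u]; outside [D] it is 0 by default. *)
have eP z : exists e : V z, D z -> forall u (a : V u), up_supp V x0 u ->
    prec Q z%:E u%:E -> smap V u x0 a = w -> smap V u z a = e.
  have [Dz|nDz] := pselect (D z); last by exists 0.
  move/DE: (Dz) => [u Uu zu]; have [a aw] := wE _ Uu.
  exists (smap V u z a) => _ u' a' Uu' zu' a'w.
  have [x0u _] := up_suppP Uu; have [x0u' _] := up_suppP Uu'.
  case: (Utot _ _ Uu Uu') => uu.
    rewrite -(smap_comp a' uu zu); congr (smap V u z _).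
    by apply: (projective_inj V_proj x0u); rewrite smap_comp// aw.
  rewrite -(smap_comp a uu zu'); congr (smap V u' z _).
  by apply: (projective_inj V_proj x0u'); rewrite smap_comp// aw.
pose e z := sval (cid (eP z)).
have eE z u (a : V u) : up_supp V x0 u -> prec Q z%:E u%:E ->
    smap V u x0 a = w -> smap V u z a = e z.
  move=> Uu zu; apply: (svalP (cid (eP z))) => //.
  by apply/DE; exists u.
have [||f fE] := @rep_hom_exists (convex_rep HD) V (fun x r => rV_scalar r *: e x).
- by move=> x a r s; rewrite rV_scalar_is_linear scalerDl -scalerA.
- move=> x y r yx; rewrite convex_smapE// linearZ /=.
  have [Dx|nDx] := pselect (D x); last first.
    have -> : r = 0 by apply: rV_scalar_inj => /nDx.
    by rewrite !linear0 /rV_scalar !big1 ?scale0r// => i _; rewrite mxE.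
  rewrite rV_scalar_unit_map ?(Ddown _ _ yx)//.
  move/DE: Dx => [u Uu xu]; have [a aw] := wE _ Uu.
  by rewrite -(eE _ _ _ Uu xu aw) smap_comp// (eE y u a)// (prec_trans yx).
apply: (@indecomposable_retract _ _ f g) => // [D_zero|x r].
  have := D_zero x0 (const_mx 1) => /(congr1 (@rV_scalar k _)).
  rewrite rV_scalar_const// /rV_scalar big1 => [/eqP|i _]; last by rewrite mxE.
  by rewrite oner_eq0.
rewrite fE; apply: rV_scalar_inj => Dx.
have [u Uu xu] := (DE x).1 Dx; have [a aw] := wE _ Uu.
(* Naturality moves the computation up to [u], where [g] gives the value of [phi] at [w]. *)
have gex : rV_scalar (g x (e x)) = 1.
  by rewrite -(eE _ _ _ Uu xu aw) hom_natE// convex_smapE// rV_scalar_unit_map// gE// aw.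
by rewrite linearZ /= rV_scalarZ gex mulr1.
Qed.

End Reps.

(** * Choice of the base point *)

Section Base.
Context {R : realType} (k : fieldType) (Q : quiverA R) (V : rep k Q).

Lemma up_supp_chain_base : ~ rep_zero V -> exists x0, exists2 v0 : V x0, v0 <> 0 &
  forall x y, up_supp V x0 x -> up_supp V x0 y ->
    prec Q x%:E y%:E \/ prec Q y%:E x%:E.
Proof.
move=> V0.
(* The points above a non-minimal point lie on a single arc with it. *)
have [[x1 [x0 [le ne [v v0]]]]|noabove] := pselect (exists x1 x0 : R,
    [/\ prec Q x1%:E x0%:E, x1%:E <> x0%:E :> \bar R & exists v : V x0, v <> 0]).
  exists x0, v => // x y /andP[x0x _] /andP[x0y _].
  exact: prec_up_total ne le x0x x0y.
have [x0 [v v0]] : exists x0 (v : V x0), v <> 0.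
  apply: contrapT => h; apply: V0 => x v; apply: contrapT => v0.
  by apply: h; exists x, v.
(* Now [V] vanishes at every non-minimal point, in particular strictly above [x0], so [U] is reduced
   to [x0]. *)
have Ueq x : up_supp V x0 x -> x%:E = x0%:E :> \bar R.
  move=> /up_suppP[x0x [a a0]]; apply: contrapT => ne; apply: noabove.
  exists x0, x; split=> //; first by move=> e; apply: ne.
  by exists a => a00; apply: a0; rewrite a00 linear0.
by exists x0, v => // x y /Ueq-> /Ueq->; left; apply: prec_refl.
Qed.

End Base.

Theorem theorem3 (R : realType) (k : fieldType) (Q : quiverA R) (V : rep k Q)
    (V_indecomposable : indecomposable V) (V_projective : projective V) :
  (exists a : R, rep_iso V (P_at k Q a)) \/
  (exists a : \bar R, rep_iso V (P_left k Q a)) \/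
  (exists a : \bar R, rep_iso V (P_right k Q a)).
Proof.
have [x0 [v0 v00 Utot]] := up_supp_chain_base V_indecomposable.1.
have [[u Uu umax]|nomax] := pselect (exists2 u, up_supp V x0 u &
    forall y, up_supp V x0 y -> prec Q y%:E u%:E).
  (* With a greatest element [u], the down-set generated by [U] is that of [u] alone. *)
  left; exists u; apply: (indecomposable_projective_thin _ _ _ _ v00) => // z.
  split=> [zu|[y Uy zy]]; first by exists u.
  exact: prec_trans zy (umax _ Uy).
have Unomax x : up_supp V x0 x -> exists2 y, up_supp V x0 y & ~ prec Q y%:E x%:E.
  move=> Ux; apply: contrapT => h; apply: nomax; exists x => // y Uy.
  by apply: contrapT => nyx; apply: h; exists y.
have Ule x : up_supp V x0 x -> prec Q x0%:E x%:E by move=> /andP[].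
right; have [[a aE]|[a aE]] := nomax_shape (up_supp_base v00) Ule Utot Unomax.
- by left; exists a; apply: (indecomposable_projective_thin _ _ _ _ v00).
- by right; exists a; apply: (indecomposable_projective_thin _ _ _ _ v00).
Qed.
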